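(* The cone $\sigma^\vee$ associated to the $7$-vertex triangulation $T_7$ of the torus is a $9$-dimensional completely split reflexive Gorenstein cone of index $3$. It is the Cayley cone over three $6$-dimensional lattice simplices.
   Context: $T_7$ is the unique (equivelar) triangulation of the torus with $7$ vertices: $\mathrm{vert}\,T_7=\mathbb Z/7$, with principal translations $\tau_1=1$, $\tau_2=4$, $\tau_3=2$ in $\mathbb Z/7$ (so $\tau_1+\tau_2+\tau_3=0$), and the $14$ triangles $\{p,p+1,p+5\}$, $\{p,p+1,p+3\}$, $p\in\mathbb Z/7$. Every pair of vertices is an edge; each edge is uniquely of the form $\{p,p+\tau_k\}$. Let $\epsilon_1,\epsilon_2,\epsilon_3$, $e_p$ ($p\in\mathbb Z/7$) be the standard basis of $\mathbb Z^3\oplus\mathbb Z^7$. With $\{i,j,k\}=\{1,2,3\}$ put $A_{p,p+\tau_k}=\epsilon_k+e_p+e_{p+\tau_k}-e_{p-\tau_i}-e_{p-\tau_j}$. $M$ is the (rank $9$) lattice generated by these $21$ vectors, and $\sigma^\vee\subset M_{\mathbb R}$ is the cone they generate. A rational finite polyhedral cone $C\subset M_{\mathbb R}$ is Gorenstein if there is $n_C\in N=\mathrm{Hom}(M,\mathbb Z)$ with $\langle v,n_C\rangle=1$ for all primitive generators $v\in M$ of rays of $C$. $C$ is reflexive if also the dual cone $C^\vee\subset N_{\mathbb R}$ is Gorenstein, with determining lattice point $m_{C^\vee}\in M$; its index is $\langle m_{C^\vee},n_C\rangle$. For lattice polytopes $\Delta_1,\dots,\Delta_r\subset\Lambda_{\mathbb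 R}$ ($\Lambda$ a lattice) the associated Cayley cone is $\{(\lambda_1,\dots,\lambda_r,\sum\lambda_ix_i):\lambda_i\ge0,\ x_i\in\Delta_i\}\subset\mathbb R^r\oplus\Lambda_{\mathbb R}$, with lattice $\mathbb Z^r\oplus\Lambda$. A reflexive Gorenstein cone of index $r$ is completely split if it is the Cayley cone associated to $r$ lattice polytopes. *)

(* Defs.v *)
From HB Require Import structures.
From mathcomp Require Import all_boot all_order all_algebra.
From mathcomp Require Import boolp classical_sets reals.

Set Implicit Arguments.
Unset Strict Implicit.
Unset Printing Implicit Defensive.

Import Order.TTheory GRing.Theory Num.Theory.

Local Open Scope ring_scope.

(* The principal translations tau_1, tau_2, tau_3 are tau 0, tau 1, tau 2. *)
Definition tau (k : 'I_3) : 'Z_7 := tnth [tuple 1; 4; 2] k.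

Definition T7_triangles : {set {set 'Z_7}} :=
  [set [set p; p + 1; p + 5] | p in 'Z_7]%SET :|:
  [set [set p; p + 1; p + 3] | p in 'Z_7]%SET.

Definition T7_edges : {set {set 'Z_7}} :=
  [set E : {set 'Z_7} | (#|E| == 2)
     && [exists T : {set 'Z_7}, (T \in T7_triangles) && (E \subset T)]]%SET.

Definition T7_edge (pk : 'Z_7 * 'I_3) : {set 'Z_7} :=
  [set pk.1; pk.1 + tau pk.2]%SET.

Local Lemma all7 (P : 'Z_7 -> Prop) :
  P 0 -> P 1 -> P 2 -> P 3 -> P 4 -> P 5 -> P 6 -> forall p, P p.
Proof.
move=> P0 P1 P2 P3 P4 P5 P6 [[|[|[|[|[|[|[|m]]]]]]] hm] //.
- by rewrite (_ : Ordinal hm = 0) //; apply/val_inj.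
- by rewrite (_ : Ordinal hm = 1) //; apply/val_inj.
- by rewrite (_ : Ordinal hm = 2) //; apply/val_inj.
- by rewrite (_ : Ordinal hm = 3) //; apply/val_inj.
- by rewrite (_ : Ordinal hm = 4) //; apply/val_inj.
- by rewrite (_ : Ordinal hm = 5) //; apply/val_inj.
- by rewrite (_ : Ordinal hm = 6) //; apply/val_inj.
Qed.

Local Lemma all3 (P : 'I_3 -> Prop) : P 0 -> P 1 -> P 2 -> forall k, P k.
Proof.
move=> P0 P1 P2 [[|[|[|m]]] hm] //.
- by rewrite (_ : Ordinal hm = 0) //; apply/val_inj.
- by rewrite (_ : Ordinal hm = 1) //; apply/val_inj.
- by rewrite (_ : Ordinal hm = 2) //; apply/val_inj.
Qed.

Lemma T7_edge_inj : injective T7_edge.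
Proof.
move=> [p k] [q l] /setP E.
have := E p; have := E (p + tau k); have := E q; have := E (q + tau l).
rewrite !inE /= !eqxx ?orbT {E}.
have [-> | npq] := eqVneq p q.
  by elim/all7: q; elim/all3: k; elim/all3: l.
move: npq.
by elim/all7: p; elim/all7: q; elim/all3: k; elim/all3: l.
Qed.

Lemma T7_edgesE : T7_edges = [set T7_edge pk | pk : 'Z_7 * 'I_3]%SET.
Proof.
apply/setP => E; apply/idP/imsetP => [|[[p k] _ ->]]; last first.
  rewrite inE cards2; apply/andP; split.
    by elim/all7: p; elim/all3: k.
  apply/existsP; case: (eqVneq k 0) => [->|k0].
    exists [set p; p + 1; p + 5]%SET; apply/andP; split.
      by rewrite inE; apply/orP; left; apply/imsetP; exists p.
    by rewrite /T7_edge /= finset.subsetUl.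
  pose q := p - 1.
  exists (if k == 1 then [set q; q + 1; q + 5] else [set q; q + 1; q + 3])%SET.
  apply/andP; split.
    by rewrite inE; case: eqP => _; apply/orP; [left | right];
      apply/imsetP; exists q.
  apply/fintype.subsetP => x; rewrite /q /T7_edge !inE /=; clear q.
  move: k0; elim/all3: k => //= _; rewrite ?inE;
    by move: p x; elim/all7 => x; elim/all7: x.
rewrite inE => /andP[/cards2P[a [b [nab ->]]] _].
suff [pk]: exists pk : 'Z_7 * 'I_3, ((pk.1 == a) && (pk.1 + tau pk.2 == b))
                   || ((pk.1 == b) && (pk.1 + tau pk.2 == a)).
  move=> /orP[] /andP[/eqP h1 /eqP h2]; exists pk => //; rewrite /T7_edge h2 h1 //.
  by rewrite finset.setUC.
pose d := b - a.
have [k] : exists k, (d == tau k) || (d == - tau k).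
  have : d != 0 by rewrite subr_eq0 eq_sym.
  elim/all7: d => // _; try (by exists 0); try (by exists 1); by exists 2.
case/orP => /eqP dk.
  by exists (a, k); rewrite /= -dk /d addrC subrK !eqxx.
by exists (b, k); rewrite /= -[tau k]opprK -dk /d opprB addrC subrK !eqxx orbT.
Qed.

Local Open Scope classical_set_scope.

Section Lattices.
Variable R : realType.
Implicit Types V W : vectType R.

Definition zspan V (I : finType) (v : I -> V) : set V :=
  [set x | exists z : I -> int, x = \sum_i v i *~ z i].

Definition cone_hull V (I : finType) (v : I -> V) : set V :=
  [set x | exists2 c : I -> R, (forall i, 0 <= c i) & x = \sum_i c i *: v i].

Definition convex_hull V (I : finType) (v : I -> V) : set V :=
  [set x | exists c : I -> R,
     [/\ forall i, 0 <= c i, \sum_i c i = 1 & x = \sum_i c i *: v i]].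

(* L is a lattice of full rank: V = L (x) R. *)
Definition is_lattice V (L : set V) : Prop :=
  exists (n : nat) (b : n.-tuple V),
    basis_of fullv b /\ L = zspan (tnth b).

(* For a lattice L with V = L (x) R, integral functionals on V are the same
   thing as elements of Hom(L, Z), and 'Hom(V, R^o) = Hom(L, Z) (x) R. *)
Definition dual_lattice V (L : set V) : set 'Hom(V, R^o) :=
  [set f | forall v, L v -> exists z : int, f v = z%:~R].

Definition dual_cone V (C : set V) : set 'Hom(V, R^o) :=
  [set f | forall v, C v -> 0 <= (f v : R)].

Definition ev V (v : V) : 'Hom('Hom(V, R^o), R^o) :=
  linfun (fun f : 'Hom(V, R^o) => f v).

Lemma evE V (v : V) (f : 'Hom(V, R^o)) : ev v f = f v.
Proof.
have lin : linear (fun g : 'Hom(V, R^o) => g v : R^o).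
  by move=> a g h; rewrite add_lfunE scale_lfunE.
pose lm := GRing.isLinear.Build _ _ _ _ (fun g : 'Hom(V, R^o) => g v : R^o) lin.
pose F : {linear 'Hom(V, R^o) -> R^o} := HB.pack (fun g : 'Hom(V, R^o) => g v : R^o) lm.
exact: (lfunE F f).
Qed.

Definition rational_polyhedral V (L C : set V) : Prop :=
  exists (n : nat) (v : 'I_n -> V), (forall i, L (v i)) /\ C = cone_hull v.

Definition is_face V (C F : set V) : Prop :=
  exists2 f : 'Hom(V, R^o), dual_cone C f & F = [set x | C x /\ f x = 0].

Definition primitive V (L : set V) (v : V) : Prop :=
  [/\ L v, v != 0 & forall (w : V) (k : nat), L w -> v = w *+ k -> k = 1%N].

Definition primitive_ray_generator V (L C : set V) (v : V) : Prop :=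
  primitive L v /\ is_face C [set x | exists2 t : R, 0 <= t & x = t *: v].

Definition gorenstein V (L C : set V) (n : 'Hom(V, R^o)) : Prop :=
  [/\ rational_polyhedral L C, dual_lattice L n
    & forall v, primitive_ray_generator L C v -> n v = 1].

(* The determining point of C^vee lies in Hom(Hom(L, Z), Z); it is given
   through biduality as ev m with m in L.  The index is n m. *)
Definition reflexive_gorenstein V (L C : set V) (r : nat) : Prop :=
  exists (n : 'Hom(V, R^o)) (m : V),
    [/\ gorenstein L C n, L m,
        gorenstein (dual_lattice L) (dual_cone C) (ev m) & n m = r%:R].

(* The dimension of a cone is that of its linear hull U. *)
Definition cone_dim V (C : set V) (d : nat) : Prop :=
  exists U : {vspace V},
    [/\ forall x, C x -> x \in U,
        forall U' : {vspace V}, (forall x, C x -> x \in U') -> (U <= U')%VS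
      & \dim U = d].

Definition lattice_polytope W (L : set W) (D : set W) : Prop :=
  exists (n : nat) (v : 'I_n.+1 -> W), (forall i, L (v i)) /\ D = convex_hull v.

Definition lattice_simplex W (L : set W) (d : nat) (D : set W) : Prop :=
  exists v : 'I_d.+1 -> W,
    [/\ forall i, L (v i),
        free [seq v (lift ord0 i) - v ord0 | i <- enum 'I_d]
      & D = convex_hull v].

Definition cayley_cone W (r : nat) (D : 'I_r -> set W) : set ('rV[R]_r * W) :=
  [set u | exists (l : 'I_r -> R) (x : 'I_r -> W),
     [/\ forall i, 0 <= l i, forall i, D i (x i)
       & u = (\row_i l i, \sum_i l i *: x i)]].

Definition cayley_lattice W (r : nat) (L : set W) : set ('rV[R]_r * W) :=
  [set u : 'rV[R]_r * W |
     (forall i, exists z : int, u.1 ord0 i = z%:~R) /\ L u.2].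

Definition lattice_cone_iso V V' (L C : set V) (L' C' : set V') : Prop :=
  exists phi : 'Hom(V, V'),
    [/\ bijective phi, phi @` L = L' & phi @` C = C'].

Definition is_cayley_cone_over V (L C : set V) W (r : nat) (LW : set W)
    (D : 'I_r -> set W) : Prop :=
  lattice_cone_iso L C (@cayley_lattice W r LW) (cayley_cone D).

Definition completely_split V (L C : set V) (r : nat) : Prop :=
  reflexive_gorenstein L C r /\
  exists (W : vectType R) (LW : set W) (D : 'I_r -> set W),
    [/\ is_lattice LW, forall i, lattice_polytope LW (D i)
      & is_cayley_cone_over L C LW D].

End Lattices.

Section T7.
Variable R : realType.

Definition eps (k : 'I_3) : ('rV[R]_3 * 'rV[R]_7)%type := (delta_mx 0 k, 0).
Definition e_ (p : 'Z_7) : ('rV[R]_3 * 'rV[R]_7)%type := (0, delta_mx 0 p).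

(* The pair (p, k) stands for the edge T7_edge (p, k) = {p, p + tau k}; by
   T7_edgesE and T7_edge_inj every edge of T_7 occurs exactly once. *)
Definition A_ (pk : 'Z_7 * 'I_3) : ('rV[R]_3 * 'rV[R]_7)%type :=
  let: (p, k) := pk in
  eps k + e_ p + e_ (p + tau k) - \sum_(i < 3 | i != k) e_ (p - tau i).

(* M (x) R, realised as the real span of M inside R^3 (+) R^7. *)
Definition M_R : vectType R := subvs_of <<[seq A_ pk | pk : 'Z_7 * 'I_3]>>%VS.

Definition A_in_M_R (pk : 'Z_7 * 'I_3) : M_R := vsproj _ (A_ pk).

Lemma A_in_M_RE (pk : 'Z_7 * 'I_3) : vsval (A_in_M_R pk) = A_ pk.
Proof. by rewrite /A_in_M_R vsprojK // memv_span //; exact: fintype.image_f. Qed.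

Definition lattice_M : set M_R := zspan A_in_M_R.

Definition sigma_dual : set M_R := cone_hull A_in_M_R.

End T7.

Arguments lattice_M : clear implicits.
Arguments sigma_dual : clear implicits.

(* Main.v *)
From HB Require Import structures.
From Stdlib Require Import NArith.
Require Import Defs.
From mathcomp Require Import all_boot all_order all_algebra ring.
From mathcomp Require Import boolp classical_sets reals.

(** The differences [A (p, k) - A (p - tau k, k)] do not depend on [k]. Hence a
    functional on [M_R] is given by its 21 values [x p k] on the [A (p, k)],
    subject to [x p k - x (p - tau k) k] being independent of [k]. The dual cone
    turns out to be generated by 24 functionals taking only the values 0 and 1:
    the three coordinates along [eps], and 21 "staircases". A nonnegative [x]
    decomposes into them by subtracting maximal multiples, provided that a
    nonzero [x] always has some generator supported inside its support; this is
    a finite statement on the possible zero sets of [x]. All 24 generators take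
    the value 1 on [eps_1 + eps_2 + eps_3], which lies in [M] since it is the sum
    of the [A] of the three long diagonals of a vertex link, and the sum of the
    [eps] coordinates is 1 on every [A (p, k)]: the cone is reflexive of index 3.

    By the same relation, [A (0, k)] and [A (q, 0) - A (0, 0)] form a basis of
    [M]. In this basis the cone is a Cayley cone, and for each [k] the
    differences of the vertices of the k-th slice generate the lattice, so that
    the slices are simplices. *)

Set Implicit Arguments.
Unset Strict Implicit.
Unset Printing Implicit Defensive.

Import Order.TTheory GRing.Theory Num.Theory.

Local Open Scope ring_scope.

(** * Hitting sets *)

(* A set of natural numbers is encoded by the bits of an element of N; a rule
   (a, b) says that every admissible set containing a contains b. *)
Section HittingSets.
Variable rules : seq (N * N).

Definition bits (s : seq N) : N := foldr (fun i m => N.setbit m i) N0 s.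

Definition submask (a b : N) : bool := N.eqb (N.land a b) a.

Definition saturate (X : N) : N :=
  foldl (fun X r => if submask r.1 X then N.lor r.2 X else X) X rules.

Definition insert_minimal (X : N) (L : seq N) : seq N :=
  if has (submask^~ X) L then L else X :: [seq T <- L | ~~ submask X T].

(** Any number of saturation passes is sound; five are made, without a test for a fixed point. *)
Definition extend (s : seq N) (X : N) : seq N :=
  if has (N.testbit X) s then [:: X]
  else [seq iter 5 saturate (N.setbit X i) | i <- s].

Definition hitting_step (L : seq N) (s : seq N) : seq N :=
  foldr insert_minimal [::] (flatten [seq extend s X | X <- L]).

(* The search branches on the element by which a set meets the next member of
   ss, saturates under the rules and discards the non-minimal sets. *)
Definition hitting_sets (ss : seq (seq N)) : seq N :=
  foldl hitting_step [:: N0] ss.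

Variable z : N -> bool.
Definition below (X : N) : Prop := forall i, N.testbit X i -> z i.

Lemma below_bits s : below (bits s) <-> {in s, forall i, z i}.
Proof.
elim: s => [|i s [IH1 IH2]]; first by split=> // _ j; rewrite N.bits_0.
split=> [h j|h j /N.setbit_iff[<-|]].
- rewrite inE => /orP[/eqP->|js]; first by apply/h/N.setbit_iff; left.
  by apply: IH1 j js => j js; apply/h/N.setbit_iff; right.
- by rewrite h ?mem_head.
- by apply: IH2 => k ks; rewrite h ?inE ?ks ?orbT.
Qed.

Lemma below_submask a b : submask a b -> below b -> below a.
Proof.
move=> /N.eqb_eq ab bz i ai; apply: bz.
by move: ai; rewrite -ab N.land_spec => /andP[].
Qed.

Hypothesis rules_sound : forall r, r \in rules -> below r.1 -> below r.2.

Lemma below_saturate X : below X -> below (saturate X).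
Proof.
rewrite /saturate; elim: rules rules_sound X => //= r rs IH rP X Sz.
apply: IH => [t ts|]; first by apply: rP; rewrite inE ts orbT.
case: ifP => // rS i; rewrite N.lor_spec => /orP[|/Sz//].
by apply: rP (mem_head _ _) _ i; apply: below_submask rS Sz.
Qed.

(** The invariant of the search: some candidate lies inside [z]. *)
Definition covers (L : seq N) : Prop := exists2 X, X \in L & below X.

(** A discarded set contains one that is kept, and [below] passes to subsets. *)
Lemma covers_minimal L : covers L -> covers (foldr insert_minimal [::] L).
Proof.
elim: L => [|X L IH] //= [T]; rewrite inE => TL Tz.
set M := foldr _ _ _ in IH *; rewrite /insert_minimal.
have [{}IH | TS] : covers M \/ T = X.
- by case/orP: TL => [/eqP|TL]; [right | left; apply: IH; exists T].
- case: ifP => // _; have [U UM Uz] := IH.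
  case SU: (submask X U).
    by exists X; [exact: mem_head | exact: below_submask SU Uz].
  by exists U; rewrite // inE mem_filter SU UM orbT.
- case: ifP => [/hasP[U UM US]|_].
    by exists U => //; apply: below_submask US _; rewrite -TS.
  by exists X; [exact: mem_head | rewrite -TS].
Qed.

Lemma covers_hitting_step L s :
  (exists2 i, i \in s & z i) -> covers L -> covers (hitting_step L s).
Proof.
move=> [i is_ zi] [X SL Sz]; apply: covers_minimal.
suff [T TS Tz] : covers (extend s X).
  by exists T => //; apply/flattenP; exists (extend s X) => //; exact: map_f.
rewrite /extend; case: ifP => _; first by exists X => //; exact: mem_head.
exists (iter 5 saturate (N.setbit X i)); first exact: map_f.
elim: 5%N => [j /N.setbit_iff[<-//|/Sz//]|n IH]; exact: below_saturate.
Qed.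

Lemma covers_hitting_sets (ss : seq (seq N)) :
  (forall s, s \in ss -> exists2 i, i \in s & z i) -> covers (hitting_sets ss).
Proof.
have : covers [:: N0] by exists N0 => [|i]; rewrite ?mem_head ?N.bits_0.
rewrite /hitting_sets; elim: ss [:: N0] => //= s ss IH L Lz sP.
apply: IH => [|t ts]; last by apply: sP; rewrite inE ts orbT.
by apply: covers_hitting_step => //; apply: sP; exact: mem_head.
Qed.

End HittingSets.

(** * Zero sets on the edges of the triangulation *)

(* The ray (q, j) of the dual cone takes the value 1 on A_ (p, k) if
   staircase q j p k, and 0 otherwise. *)
Definition staircase (q j p k : nat) : bool :=
  ((p + (7 - q)) * nth 0 [:: 1; 2; 4] j %% 7 \in
   nth [::] [:: [:: 0]; [:: 0; 4]; [:: 0; 2; 4; 6]] ((k + (3 - j)) %% 3))%N.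

(** Numbers the 21 pairs from 0 to 20; the reductions let indices such as [p + tau_opp l] or [t.+1]
    wrap around. *)
Definition code (p k : nat) : N := bin_of_nat (3 * (p %% 7) + k %% 3).

(* Represents - tau k modulo 7. *)
Definition tau_opp (k : nat) : nat := nth 0%N [:: 6; 3; 5] (k %% 3).

(** By A (p, k) + A (p - tau l, l) = A (p, l) + A (p - tau k, k), a nonnegative functional that
    vanishes on the left terms vanishes on the right ones. *)
Definition exchange_rule (p k l : nat) : N * N :=
  (bits [:: code p k; code (p + tau_opp l) l],
   bits [:: code p l; code (p + tau_opp k) k]).

(* The three long diagonals of the hexagonal link of the vertex t; the sum
   of the corresponding vectors A_ does not depend on t. *)
Definition diagonals (t : nat) : N :=
  bits [:: code (t + 3) 0; code (t + 5) 1; code (t + 6) 2].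

Definition T7_rules : seq (N * N) :=
  [seq exchange_rule pk.1 pk.2 l |
     pk <- [seq (p, k) | p <- iota 0 7, k <- iota 0 3], l <- iota 0 3] ++
  [seq (diagonals t, diagonals t.+1) | t <- iota 0 7].

(** The supports of the three [eps] coordinates, then those of the 21 staircases. *)
Definition T7_supports : seq (seq N) :=
  [seq [seq code p k | p <- iota 0 7] | k <- iota 0 3] ++
  [seq [seq code pk.1 pk.2 | pk <- [seq (p, k) | p <- iota 0 7, k <- iota 0 3]
                           & staircase q j pk.1 pk.2]
    | q <- iota 0 7, j <- iota 0 3].


(** 2097151 is 2^21 - 1, the set of all 21 pairs: a set closed under the rules that meets every
    support is everything. *)
Lemma hitting_sets_T7 : hitting_sets T7_rules T7_supports = [:: 2097151%num].
Proof. by vm_cast_no_check (erefl [:: 2097151%num]). Qed.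

Lemma Zp7D (m n : nat) : inZp (m + n) = inZp m + inZp n :> 'Z_7.
Proof. by apply/val_inj; rewrite /= modnDm. Qed.

Lemma Zp7_tau_opp (l : nat) : inZp (tau_opp l) = - tau (inZp l) :> 'Z_7.
Proof.
have -> : inZp l = inZp (l %% 3) :> 'I_3 by apply/val_inj; rewrite /= modn_mod.
rewrite /tau_opp; have : (l %% 3 < 3)%N by rewrite ltn_pmod.
by case: (l %% 3)%N => [|[|[|//]]] _; apply/val_inj.
Qed.

Lemma mem_iota_pairs (x : nat * nat) :
  x \in [seq (p, k) | p <- iota 0 7, k <- iota 0 3] = (x.1 < 7)%N && (x.2 < 3)%N.
Proof.
case: x => p k; apply/allpairsP/idP => [[[p' k']] []|/andP[p7 k3]].
  by rewrite !mem_iota => p7 k3 [-> ->]; apply/andP.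
by exists (p, k); rewrite !mem_iota.
Qed.

(** [Z] stands for the zero set of a nonnegative functional. The first two hypotheses reflect linear
    relations among the A, the last two say that [Z] meets the support of every ray. *)
Lemma blocking (Z : 'Z_7 -> 'I_3 -> bool) :
  (forall p k l, Z p k -> Z (p - tau l) l -> Z p l && Z (p - tau k) k) ->
  (forall s t, [&& Z (s + 3) 0, Z (s + 5) 1 & Z (s + 6) 2] ->
               [&& Z (t + 3) 0, Z (t + 5) 1 & Z (t + 6) 2]) ->
  (forall k, exists p, Z p k) ->
  (forall (q : 'Z_7) (j : 'I_3), exists (p : 'Z_7) (k : 'I_3), staircase q j p k && Z p k) ->
  forall p k, Z p k.
Proof.
move=> exch diag rows stairs.
(* [inZp] reduces modulo 7 and modulo 3, so [z] decodes [code]. *)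
pose z (i : N) := Z (inZp (nat_of_bin i %/ 3)) (inZp (nat_of_bin i)).
have zE p k : z (code p k) = Z (inZp p) (inZp k).
  rewrite /z /code bin_of_natK; congr Z; apply/val_inj => /=.
    by rewrite mulnC divnMDl // (divn_small (ltn_pmod _ _)) // addn0 modn_mod.
  by rewrite mulnC modnMDl modn_mod.
have zZ (p : 'Z_7) (k : 'I_3) : z (code p k) = Z p k by rewrite zE !valZpK.
have diagP t : below z (diagonals t) <->
    [&& Z (inZp t + 3) 0, Z (inZp t + 5) 1 & Z (inZp t + 6) 2].
  have zt (n : 'Z_7) (i : 'I_3) : z (code (t + n) i) = Z (inZp t + n) i.
    by rewrite zE Zp7D !valZpK.
  split=> [/below_bits h|/and3P[h0 h1 h2]].
    apply/and3P; split; [rewrite -(zt 3 0)|rewrite -(zt 5 1)|rewrite -(zt 6 2)];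
      by apply: h; rewrite !inE eqxx ?orbT.
  by apply/below_bits => i; rewrite !inE => /or3P[] /eqP->;
    [exact: etrans (zt 3 0) h0|exact: etrans (zt 5 1) h1|exact: etrans (zt 6 2) h2].
have rulesP r : r \in T7_rules -> below z r.1 -> below z r.2.
  rewrite mem_cat => /orP[/allpairsP[[[p k] l] [_ _ ->]]|/mapP[t _ ->]].
    move=> /below_bits h; apply/below_bits => i; have := h _ (mem_head _ _).
    have := h (code (p + tau_opp l) l); rewrite !inE eqxx orbT => /(_ isT).
    rewrite !zE !Zp7D !Zp7_tau_opp => h1 h2; have /andP[h3 h4] := exch _ _ _ h2 h1.
    by case/orP => /eqP->; rewrite zE // Zp7D Zp7_tau_opp.
  by move=> /(diagP t)/(diag _ (inZp t.+1))/(diagP t.+1).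
have suppP s : s \in T7_supports -> exists2 i, i \in s & z i.
  rewrite /T7_supports mem_cat => /orP[].
    case/mapP => k; rewrite mem_iota => /andP[_ k3] ->.
    have [p Zp] := rows (Ordinal k3); exists (code p k); last by rewrite -zZ in Zp.
    by apply/mapP; exists (val p); rewrite ?mem_iota ?ltn_ord.
  case/allpairsP => -[q j] []; rewrite !mem_iota => /andP[_ q7] /andP[_ j3] ->.
  have [p [k /andP[st Zpk]]] := stairs (Ordinal q7) (Ordinal j3).
  exists (code p k); last by rewrite zZ.
  apply/mapP; exists (val p, val k) => //.
  by rewrite mem_filter st mem_iota_pairs !ltn_ord.
have [X] := covers_hitting_sets rulesP suppP.
rewrite hitting_sets_T7 inE => /eqP-> Xz p k; rewrite -zZ; apply: Xz.
by elim/Defs.all7: p; elim/Defs.all3: k.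
Qed.

(** * Cones and lattices *)

Local Open Scope classical_set_scope.

Section Cones.
Variable R : realType.
Implicit Types V W : vectType R.

Lemma span_imageP V (I : finType) (v : I -> V) (x : V) :
  x \in <<[seq v i | i : I]>>%VS -> exists c : I -> R, x = \sum_i c i *: v i.
Proof.
rewrite span_def big_image => /memv_sumP[vs vsP ->].
have /choice[c cP] : forall i, exists t, vs i = t *: v i.
  by move=> i; apply/vlineP/vsP.
by exists c; apply: eq_bigr.
Qed.

Lemma zspan_gen V (I : finType) (v : I -> V) i : zspan v (v i).
Proof.
exists (fun j => (j == i)%:R).
rewrite (bigD1 i) //= eqxx big1 ?addr0 // => j /negPf->.
by rewrite mulr0z.
Qed.

Lemma zspan_add V (I : finType) (v : I -> V) x y :
  zspan v x -> zspan v y -> zspan v (x + y).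
Proof.
move=> [z ->] [w ->]; exists (fun i => z i + w i).
by rewrite -big_split; apply: eq_bigr => i _; rewrite mulrzDr.
Qed.

Lemma zspan_mulz V (I : finType) (v : I -> V) x (n : int) :
  zspan v x -> zspan v (x *~ n).
Proof.
move=> [z ->]; exists (fun i => z i * n).
by rewrite mulrz_suml; apply: eq_bigr => i _; rewrite mulrzA.
Qed.

Lemma zspan_sum V (I J : finType) (v : I -> V) (F : J -> V) :
  (forall j, zspan v (F j)) -> zspan v (\sum_j F j).
Proof.
move=> FP; elim/big_ind: _ => [|x y|//]; last exact: zspan_add.
exists (fun=> 0); rewrite big1 // => i _; exact: mulr0z.
Qed.

Lemma image_zspan V W (I : finType) (v : I -> V) (phi : 'Hom(V, W)) :
  phi @` zspan v = zspan (fun i => phi (v i)).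
Proof.
apply/seteqP; split=> [_ [_ [z ->] <-]|_ [z ->]].
  by exists z; rewrite linear_sum; apply: eq_bigr => i _; rewrite raddfMz.
exists (\sum_i v i *~ z i); first by exists z.
by rewrite linear_sum; apply: eq_bigr => i _; rewrite raddfMz.
Qed.

Lemma image_cone_hull V W (I : finType) (v : I -> V) (phi : 'Hom(V, W)) :
  phi @` cone_hull v = cone_hull (fun i => phi (v i)).
Proof.
apply/seteqP; split=> [_ [_ [c c0 ->] <-]|_ [c c0 ->]].
  by exists c => //; rewrite linear_sum; apply: eq_bigr => i _; rewrite linearZ.
exists (\sum_i c i *: v i); first by exists c.
by rewrite linear_sum; apply: eq_bigr => i _; rewrite linearZ.
Qed.

Lemma dual_lattice_zspan V (I : finType) (v : I -> V) (f : 'Hom(V, R^o)) :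
  (forall i, exists z : int, f (v i) = z%:~R) -> dual_lattice (zspan v) f.
Proof.
move=> /choice[y yP] _ [z ->]; exists (\sum_i y i * z i).
rewrite linear_sum mulrz_sumr; apply: eq_bigr => i _.
by rewrite mulrzA -yP raddfMz.
Qed.

Lemma cone_hull_gen V (I : finType) (v : I -> V) i : cone_hull v (v i).
Proof.
exists (fun j => (j == i)%:R) => [j|]; first exact: ler0n.
rewrite (bigD1 i) //= eqxx scale1r big1 ?addr0 // => j /negPf->.
by rewrite scale0r.
Qed.

Lemma cone_hull_reindex V (I J : finType) (h : J -> I) (v : I -> V) :
  bijective h -> cone_hull (v \o h) = cone_hull v.
Proof.
move=> hb; have [h' hK h'K] := hb.
have sumE (F : I -> V) : \sum_i F i = \sum_j F (h j).
  by apply: reindex; apply: onW_bij.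
apply/seteqP; split=> x [c c0 ->].
  by exists (c \o h') => [i|]; rewrite ?sumE //=; apply: eq_bigr => j _; rewrite hK.
by exists (c \o h) => [j|]; rewrite ?sumE //=.
Qed.

Lemma rational_polyhedral_cone_hull V (L : set V) (I : finType) (v : I -> V) :
  (forall i, L (v i)) -> rational_polyhedral L (cone_hull v).
Proof.
move=> vL; exists #|I|, (v \o enum_val); split=> [i|]; first exact: vL.
rewrite cone_hull_reindex //; exact: enum_val_bij.
Qed.

(* A primitive ray generator w is a nonnegative multiple of some v i, and
   evaluating n shows that v i is the multiple n w of w. *)
Lemma gorenstein_cone_hull V (L : set V) (I : finType) (v : I -> V)
    (n : 'Hom(V, R^o)) :
  (forall i, L (v i)) -> (forall i, n (v i) = 1) -> dual_lattice L n ->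
  gorenstein L (cone_hull v) n.
Proof.
move=> vL nv nL; split=> //; first exact: rational_polyhedral_cone_hull.
move=> w [[wL w0 wprim] [f fC Fray]].
have [wC fw] : cone_hull v w /\ f w = 0.
  have : [set x | exists2 t : R, 0 <= t & x = t *: w] w.
    by exists 1 => //; rewrite scale1r.
  by rewrite Fray.
have fv i : 0 <= (f (v i) : R) by apply/fC/cone_hull_gen.
have [c c0 wE] := wC.
have [i ci] : exists i, c i != 0.
  apply: contrapT => /forallNP c00; case/eqP: w0; rewrite wE big1 // => i _.
  by move: (c00 i) => /negP; rewrite negbK => /eqP ->; rewrite scale0r.
have fvi : f (v i) = 0.
  have : \sum_i c i * (f (v i) : R) = 0.
    by rewrite -[RHS]fw wE linear_sum; apply: eq_bigr => j _; rewrite linearZ.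
  move/eqP; rewrite psumr_eq0 => [|j _]; last exact: mulr_ge0.
  by move/allP/(_ i (mem_index_enum _)); rewrite /= mulf_eq0 (negPf ci) => /eqP.
have [t t0 vE] : exists2 t : R, 0 <= t & v i = t *: w.
  have : [set x | cone_hull v x /\ f x = 0] (v i).
    by split=> //; exact: cone_hull_gen.
  by rewrite -Fray.
have tn : t * (n w : R) = 1 by rewrite -(nv i) vE linearZ.
have [z nz] := nL _ wL.
have z0 : 0 <= z.
  rewrite -(ler0z R) -nz leNgt; apply/negP => nw0.
  have := mulr_ge0_le0 t0 (ltW nw0).
  by rewrite tn leNgt ltr01.
case: z z0 nz => // k _ nz.
have wk : w = v i *+ k.
  by rewrite -scaler_nat vE scalerA mulrC -[k%:R]/(k%:~R) -nz tn scale1r.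
by rewrite nz (wprim _ _ (vL i) wk).
Qed.

(** The coefficient of a vertex is the weight of its slice times its barycentric weight within the
    slice. *)
Lemma cayley_cone_simplices W (r n : nat) (d : 'I_r -> 'I_n.+1 -> W) :
  cayley_cone (fun k => convex_hull (d k)) =
  cone_hull (fun pk : 'I_n.+1 * 'I_r =>
    (delta_mx 0 pk.2, d pk.2 pk.1) : 'rV[R]_r * W).
Proof.
have sumE (c : 'I_n.+1 -> 'I_r -> R) :
    \sum_pk c pk.1 pk.2 *: ((delta_mx 0 pk.2, d pk.2 pk.1) : 'rV[R]_r * W) =
    (\row_k \sum_p c p k, \sum_k \sum_p c p k *: d k p).
  rewrite -(pair_bigA _ (fun p k => c p k *: ((delta_mx 0 k, d k p) : 'rV[R]_r * W))).
  rewrite exchange_big /=; apply: injective_projections => /=.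
    rewrite [LHS](raddf_sum fst) /=; apply/rowP => k; rewrite mxE summxE.
    rewrite (bigD1 k) //= [X in _ + X]big1 => [|l lk].
      rewrite addr0 (raddf_sum fst) summxE; apply: eq_bigr => p _.
      by rewrite !mxE !eqxx mulr1.
    rewrite (raddf_sum fst) summxE big1 // => p _.
    by rewrite !mxE [k == l]eq_sym (negPf lk) andbF mulr0.
  rewrite [LHS](raddf_sum snd) /=; apply: eq_bigr => k _.
  by rewrite (raddf_sum snd).
apply/seteqP; split=> [_ [l [x [l0 xD ->]]]|_ [c c0 ->]].
  have /choice[c cP] := xD.
  exists (fun pk => l pk.2 * c pk.2 pk.1) => [pk|].
    by have [c0 _ _] := cP pk.2; apply: mulr_ge0.
  rewrite (sumE (fun p k => l k * c k p)); congr (_, _).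
    apply/rowP => k; rewrite !mxE -mulr_sumr.
    by have [_ -> _] := cP k; rewrite mulr1.
  apply: eq_bigr => k _; have [_ _ ->] := cP k.
  by rewrite scaler_sumr; apply: eq_bigr => p _; rewrite scalerA.
pose l k := \sum_p c (p, k).
(* A slice of weight 0 contributes nothing but still needs a point, here its first vertex; otherwise
   the coefficients are normalized. *)
pose x k := if l k == 0 then d k ord0 else \sum_p (c (p, k) / l k) *: d k p.
have l0 k : 0 <= l k by apply: sumr_ge0.
exists l, x; split=> // [k|].
  rewrite /x; case: eqP => [_|/eqP lk].
    exists (fun p => (p == ord0)%:R); split=> [p||]; first exact: ler0n.
      by rewrite (bigD1 ord0) //= big1 ?addr0 // => p /negPf->.
    rewrite (bigD1 ord0) //= scale1r big1 ?addr0 // => p /negPf->.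
    by rewrite scale0r.
  exists (fun p => c (p, k) / l k); split=> // [p|]; first exact: divr_ge0.
  by rewrite -mulr_suml divff.
transitivity (\sum_pk c (pk.1, pk.2) *:
    ((delta_mx 0 pk.2, d pk.2 pk.1) : 'rV[R]_r * W)).
  by apply: eq_bigr => -[p k].
rewrite (sumE (fun p k => c (p, k))); congr (_, _).
apply: eq_bigr => k _; rewrite /x; case: eqP => [lk|/eqP lk].
  rewrite lk scale0r big1 // => p _.
  have /eqP := lk; rewrite psumr_eq0 // => /allP/(_ p (mem_index_enum _))/eqP->.
  by rewrite scale0r.
by rewrite scaler_sumr; apply: eq_bigr => p _; rewrite scalerA mulrC divfK.
Qed.

(* If f is nonnegative on all v j, subtracting the largest possible multiple of
   some g i creates a new zero of f unless f vanishes on the support of g i. *)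
Lemma dual_cone_hull V (I J : finType) (v : J -> V) (g : I -> 'Hom(V, R^o)) :
  (forall i j, 0 <= (g i (v j) : R)) ->
  (forall i, exists j, 0 < (g i (v j) : R)) ->
  (forall f : 'Hom(V, R^o), (forall j, 0 <= (f (v j) : R)) ->
     (forall i, exists j, 0 < (g i (v j) : R) /\ f (v j) = 0) -> f = 0) ->
  dual_cone (cone_hull v) = cone_hull g.
Proof.
move=> g0 gpos blocking; apply/seteqP; split=> [f fC|_ [c c0 ->] _ [e e0 ->]];
    last first.
  rewrite sum_lfunE; apply: sumr_ge0 => i _; rewrite scale_lfunE.
  rewrite linear_sum; apply: (mulr_ge0 (c0 i)); apply: sumr_ge0 => j _.
  by rewrite linearZ; exact: (mulr_ge0 (e0 j) (g0 i j)).
have {fC} fv j : 0 <= (f (v j) : R) by apply/fC/cone_hull_gen.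
(* Induction on the number of [v j] on which [f] does not vanish. *)
have [N] := ubnP #|[set j | (f (v j) : R) != 0]%SET|.
elim: N f fv => // N IHN f fv; rewrite ltnS => fN.
case: (pselect (forall i, exists j, 0 < (g i (v j) : R) /\ f (v j) = 0)).
  move=> /(blocking _ fv) ->; exists (fun=> 0) => //.
  by rewrite big1 // => i _; rewrite scale0r.
move=> /existsNP[i /forallNP fi].
have fpos j : 0 < (g i (v j) : R) -> 0 < (f (v j) : R).
  move=> gj; rewrite lt_neqAle fv andbT eq_sym; apply/eqP => fj.
  exact: (fi j).
have [j0 gj0] := gpos i.
pose q j : R := f (v j) / g i (v j).
have [j gj qmin] := @arg_minP _ _ _ j0 (fun j => 0 < (g i (v j) : R)) q gj0.
pose f' : 'Hom(V, R^o) := f - (q j : R) *: g i.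
have f'E l : f' (v l) = (f (v l) : R) - q j * g i (v l).
  by rewrite /f' add_lfunE opp_lfunE scale_lfunE.
have f'v l : 0 <= (f' (v l) : R).
  rewrite f'E subr_ge0; have := g0 i l; rewrite le_eqVlt => /orP[/eqP<-|gl].
    by rewrite mulr0.
  by rewrite -ler_pdivlMr //; apply: qmin.
have {}IHN : cone_hull g f'.
  apply: IHN => //; apply: leq_trans fN; apply: proper_card; apply/properP.
  split; last first.
    exists j; rewrite !inE; first by rewrite gt_eqF // fpos.
    by rewrite negbK f'E /q divfK ?subrr // gt_eqF.
  apply/fintype.subsetP => l; rewrite !inE; apply: contraNneq => fl.
  rewrite f'E fl sub0r oppr_eq0.
  suff -> : (g i (v l) : R) = 0 by rewrite mulr0.
  by apply/eqP; apply: contraT => gl; have := fpos l; rewrite lt_neqAle eq_sym gl g0 fl ltxx => /(_ isT).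
have [c c0 f'c] := IHN.
exists (fun l => c l + q j * (l == i)%:R) => [l|].
  by rewrite addr_ge0 ?c0 // mulr_ge0 ?ler0n // divr_ge0.
under eq_bigr do rewrite scalerDl; rewrite big_split /= -f'c (bigD1 i) //= eqxx mulr1.
rewrite big1 ?addr0 ?subrK // => l /negPf->.
by rewrite mulr0 scale0r.
Qed.

End Cones.

(** * The vectors A and the functionals on M *)

Lemma translation_ind (k : 'I_3) (P : 'Z_7 -> Prop) :
  P 0 -> (forall p, P (p - tau k) -> P p) -> forall p, P p.
Proof.
move=> P0 PS p; have [n ->] : exists n, p = tau k *+ n.
  (* 1, 2, 4 are the inverses of 1, 4, 2 modulo 7. *)
  exists (p * nth 0%N [:: 1; 2; 4] k)%N.
  by elim/Defs.all3: k {P0 PS}; elim/Defs.all7: p; apply/val_inj.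
by elim: n => // n IHn; apply: PS; rewrite mulrSr addrK.
Qed.

Section T7Cone.
Variable R : realType.

Local Notation A := (A_in_M_R R).

Lemma M_R_generated (u : M_R R) :
  exists c : 'Z_7 * 'I_3 -> R, u = \sum_pk c pk *: A pk.
Proof.
have [c uE] := span_imageP (subvsP u); exists c; apply/val_inj.
rewrite linear_sum [LHS]uE; apply: eq_bigr => pk _.
by rewrite linearZ /= A_in_M_RE.
Qed.

Lemma eq_on_A (W : vectType R) (f g : 'Hom(M_R R, W)) :
  (forall pk, f (A pk) = g (A pk)) -> f = g.
Proof.
move=> fg; apply/lfunP => u; have [c ->] := M_R_generated u.
by rewrite !linear_sum; apply: eq_bigr => pk _; rewrite !linearZ /= fg.
Qed.

(** Completing the subtracted sum by [e_ (p - tau k)] makes it independent of k. *)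
Lemma A_E p k : A_ R (p, k) =
  eps R k + e_ R p + e_ R (p + tau k) + e_ R (p - tau k)
  - \sum_i e_ R (p - tau i).
Proof.
rewrite /A_ [\sum_(i < 3) _](bigD1 k) //= opprD.
by rewrite [in RHS]addrA addrK.
Qed.

Lemma A_exchange p k l :
  A (p, k) + A (p - tau l, l) = A (p, l) + A (p - tau k, k).
Proof.
suff h m : A_ R (p, m) - A_ R (p - tau m, m) =
    \sum_i e_ R (p + tau i) - \sum_i e_ R (p - tau i).
  have E : A (p, k) - A (p - tau k, k) = A (p, l) - A (p - tau l, l).
    by apply/val_inj; rewrite !linearB /= !A_in_M_RE !h.
  by rewrite -[A (p, k)](subrK (A (p - tau k, k))) E addrAC subrK.
rewrite !A_E subrK.
have -> : \sum_i e_ R (p - tau m - tau i) =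
          \sum_i e_ R (p + tau i) - e_ R (p + tau m) + e_ R (p - tau m - tau m).
  rewrite (bigD1 m) //= [X in _ = X - _ + _](bigD1 m) //= [e_ R (p + _) + _]addrC addrK.
  (* In Z/3 the map i -> - (m + i) fixes m and swaps the other two indices; the three tau sum to
     0. *)
  rewrite addrC (reindex_inj (h := fun i => - (m + i))) /=; last first.
    by move=> i j /oppr_inj/addrI.
  congr (_ + _); apply: eq_big => [i|i im].
    by elim/Defs.all3: m; elim/Defs.all3: i.
  congr e_; rewrite -addrA; congr (_ + _).
  by move: im; elim/Defs.all3: m; elim/Defs.all3: i => // _; apply/val_inj.
set x := eps R m; set y := e_ R p; set z := e_ R (p + _); set w := e_ R (p - _).
set s := \sum_i _; set t := \sum_i _; set v := e_ R _.
have -> : x + w + y + v - (t - z + v) = x + y + z + w - t.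
  rewrite opprD addrACA subrr addr0 opprB addrA; congr (_ - _).
  by rewrite [x + w + y]addrAC addrAC.
by rewrite opprB addrC addrA subrK.
Qed.

(** Each of t + 1, ..., t + 6 occurs once with each sign, so only the [eps] remain. *)
Lemma A_diagonals t :
  vsval (A (t + 3, 0) + A (t + 5, 1) + A (t + 6, 2)) = (const_mx 1, 0).
Proof.
have A0 p : A_ R (p, 0) =
    eps R 0 + e_ R p + e_ R (p + 1) - (e_ R (p + 3) + e_ R (p + 5)).
  rewrite /A_ big_mkcond !big_ord_recl big_ord0 /= add0r addr0.
  by congr (_ - (e_ R (p + _) + e_ R (p + _))); apply/val_inj.
have A1 p : A_ R (p, 1) =
    eps R 1 + e_ R p + e_ R (p + 4) - (e_ R (p + 6) + e_ R (p + 5)).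
  rewrite /A_ big_mkcond !big_ord_recl big_ord0 /= add0r addr0.
  by congr (_ - (e_ R (p + _) + e_ R (p + _))); apply/val_inj.
have A2 p : A_ R (p, 2) =
    eps R 2 + e_ R p + e_ R (p + 2) - (e_ R (p + 6) + e_ R (p + 3)).
  rewrite /A_ big_mkcond !big_ord_recl big_ord0 /= !addr0.
  by congr (_ - (e_ R (p + _) + e_ R (p + _))); apply/val_inj.
have tD (a b c : 'Z_7) : val (a + b) = val c -> e_ R (t + a + b) = e_ R (t + c).
  by move=> /val_inj <-; rewrite addrA.
rewrite !linearD /= !A_in_M_RE A0 A1 A2.
rewrite (tD 3 1 4) // (tD 3 3 6) // (tD 3 5 1) // (tD 5 4 2) // (tD 5 6 4) //.
rewrite (tD 5 5 3) // (tD 6 2 1) // (tD 6 6 5) // (tD 6 3 2) //.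
apply: injective_projections; apply/rowP => i; rewrite !mxE; last by ring.
by elim/Defs.all3: i; rewrite /=; ring.
Qed.

Definition coordinate_form (a : 'I_3 -> R) (b : 'Z_7 -> R)
    (u : 'rV[R]_3 * 'rV[R]_7) : R^o :=
  \sum_k a k * u.1 0 k + \sum_p b p * u.2 0 p.

Fact coordinate_form_linear a b : linear (coordinate_form a b).
Proof.
move=> c u v; rewrite /coordinate_form scalerDr !scaler_sumr addrACA -!big_split /=.
by congr (_ + _); apply: eq_bigr => i _; rewrite !mxE /GRing.scale /=; ring.
Qed.
HB.instance Definition _ a b :=
  GRing.isLinear.Build R _ _ _ (coordinate_form a b) (coordinate_form_linear a b).

Definition functional a b : 'Hom(M_R R, R^o) :=
  (linfun (coordinate_form a b) \o linfun vsval)%VF.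

Lemma functionalE a b p k : functional a b (A (p, k)) =
  a k + b p + b (p + tau k) + b (p - tau k) - \sum_i b (p - tau i).
Proof.
have fe l : coordinate_form a b (eps R l) = a l.
  rewrite /coordinate_form (bigD1 l) //= mxE !eqxx mulr1 big1.
    by rewrite addr0 big1 ?addr0 // => q _; rewrite mxE mulr0.
  by move=> i /negPf il; rewrite mxE il mulr0.
have fp q : coordinate_form a b (e_ R q) = b q.
  rewrite /coordinate_form big1 ?add0r => [|i _]; last by rewrite mxE mulr0.
  rewrite (bigD1 q) //= mxE !eqxx mulr1 big1 ?addr0 // => i /negPf il.
  by rewrite mxE il mulr0.
rewrite comp_lfunE !lfunE /= A_in_M_RE A_E linearB linear_sum !linearD /= fe !fp.
by under eq_bigr do rewrite fp.
Qed.

End T7Cone.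

(** * Rays of the dual cone and reflexivity *)

(* 7 times the values on e_ p of the ray (q, j); the values on eps k are
   2 ^ ((k - j) mod 3) / 7. *)
Definition ray_height (q j p : nat) : int :=
  nth 0 [:: 1; 1; 0; -2; 2; -2; 0]
    ((p + (7 - q)) * nth 0 [:: 1; 2; 4] j %% 7)%N.

(** Clearing the denominator 7 leaves 441 integer identities, decided by computation. *)
Lemma ray_height_bend (q : 'Z_7) (j : 'I_3) (p : 'Z_7) (k : 'I_3) :
  (2 ^ ((k + (3 - j)) %% 3))%N%:Z + ray_height q j p + ray_height q j (p + tau k)%R
    + ray_height q j (p - tau k)%R
    - \sum_i ray_height q j (p - tau i)%R
  = (7 * staircase q j p k)%N.
Proof.
rewrite !big_ord_recl big_ord0.
by elim/Defs.all3: j; elim/Defs.all3: k; elim/Defs.all7: q; elim/Defs.all7: p.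
Qed.

Section T7Rays.
Variable R : realType.

Local Notation A := (A_in_M_R R).

(** The coefficients of the first family are sevenths, yet the values on M are integers by
    [T7_rayE]. *)
Definition T7_ray (i : 'Z_7 * 'I_3 + 'I_3) : 'Hom(M_R R, R^o) :=
  match i with
  | inl (q, j) => functional (fun k => (2 ^ ((k + (3 - j)) %% 3))%N%:Z%:~R / 7)
                             (fun p => (ray_height q j p)%:~R / 7)
  | inr l => functional (fun k => (k == l)%:R) (fun=> 0)
  end.

Definition T7_ray_value (i : 'Z_7 * 'I_3 + 'I_3) (p : 'Z_7) (k : 'I_3) : bool :=
  match i with inl (q, j) => staircase q j p k | inr l => k == l end.

Lemma T7_rayE i p k : T7_ray i (A (p, k)) = (T7_ray_value i p k)%:R.
Proof.
case: i => [[q j]|l] /=; rewrite functionalE; last first.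
  by rewrite !addr0 big1 ?subr0.
rewrite -mulr_suml -!mulrDl -mulrBl.
have := congr1 (fun n : int => n%:~R : R) (ray_height_bend q j p k).
rewrite intrB !intrD [(\sum_i _)%:~R]rmorph_sum /= => ->.
by rewrite -pmulrn natrM mulrAC divff ?mul1r // pnatr_eq0.
Qed.

(** The zero set of [f] satisfies the hypotheses of [blocking], as a vanishing sum of nonnegative
    terms has only zero terms. *)
Lemma T7_blocking (f : 'Hom(M_R R, R^o)) :
  (forall pk, 0 <= (f (A pk) : R)) ->
  (forall i, exists pk, 0 < (T7_ray i (A pk) : R) /\ f (A pk) = 0) -> f = 0.
Proof.
move=> f0 hit; pose Z p k := (f (A (p, k)) : R) == 0.
have Z0 (p : 'Z_7) (k : 'I_3) : Z p k -> f (A (p, k)) = 0.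
  by move/eqP.
have rayZ i : exists p k, T7_ray_value i p k && Z p k.
  have [[p k] []] := hit i; rewrite T7_rayE => v fpk; exists p, k.
  by move: v; case: T7_ray_value; rewrite ?ltxx //= => _; apply/eqP.
apply: eq_on_A => -[p k]; rewrite zero_lfunE; apply: (Z0 p k).
apply: blocking p k => [p k l Zk Zl|s t /and3P[z0 z1 z2]|m|q j].
- have : (f (A (p, l)) : R) + f (A (p - tau k, k)) = 0.
    by rewrite -[LHS]linearD -A_exchange linearD /= (Z0 _ _ Zk) (Z0 _ _ Zl) addr0.
  by move/eqP; rewrite paddr_eq0.
- have : f (A (t + 3, 0) + A (t + 5, 1) + A (t + 6, 2)) = 0.
    have -> : A (t + 3, 0) + A (t + 5, 1) + A (t + 6, 2) =
              A (s + 3, 0) + A (s + 5, 1) + A (s + 6, 2).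
      by apply/val_inj; exact: etrans (A_diagonals R t) (esym (A_diagonals R s)).
    by rewrite !linearD /= !Z0 // !addr0.
  rewrite !linearD => /eqP.
  rewrite (@paddr_eq0 R _ _ (addr_ge0 (f0 _) (f0 _)) (f0 _)).
  by rewrite (@paddr_eq0 R _ _ (f0 _) (f0 _)) -andbA.
- have [q [l /andP[/eqP lm Zql]]] := rayZ (inr m).
  by exists q; rewrite -lm.
- exact: rayZ (inl (q, j)).
Qed.

Lemma T7_dual_cone : dual_cone (sigma_dual R) = cone_hull T7_ray.
Proof.
apply: dual_cone_hull => [i [p k]|i|]; last exact: T7_blocking.
  by rewrite T7_rayE ler0n.
suff [p [k v]] : exists p k, T7_ray_value i p k.
  by exists (p, k); rewrite T7_rayE v ltr01.
case: i => [[q j]|l]; last by exists 0, l => /=.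
(* The staircase (q, j) contains its own index. *)
exists q, j; by elim/Defs.all7: q; elim/Defs.all3: j.
Qed.

(** By [A_diagonals] at t = 0 this is eps_1 + eps_2 + eps_3, written as an element of M. *)
Definition T7_center : M_R R := A (3, 0) + A (5, 1) + A (6, 2).

Definition T7_height : 'Hom(M_R R, R^o) := functional (fun=> 1) (fun=> 0).

Lemma T7_heightE pk : T7_height (A pk) = 1.
Proof. by case: pk => p k; rewrite functionalE !addr0 big1 ?subr0. Qed.

Lemma T7_ray_center i : T7_ray i T7_center = 1.
Proof.
rewrite !linearD /= !T7_rayE.
case: i => [[q j]|l] /=; last by elim/Defs.all3: l; rewrite /= ?add0r ?addr0.
by elim/Defs.all7: q; elim/Defs.all3: j; rewrite /= ?add0r ?addr0.
Qed.

(** Each cone is generated by lattice points on which its determining element is 1. The index is 3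
    because the center is a sum of three vectors of height 1. *)
Lemma sigma_dual_reflexive :
  reflexive_gorenstein (lattice_M R) (sigma_dual R) 3.
Proof.
have centerM : lattice_M R T7_center.
  by do 2?apply: zspan_add; exact: zspan_gen.
exists T7_height, T7_center; split=> //.
- apply: gorenstein_cone_hull => [pk|pk|]; first exact: zspan_gen.
    exact: T7_heightE.
  by apply: dual_lattice_zspan => pk; exists 1; rewrite T7_heightE.
- rewrite T7_dual_cone; apply: gorenstein_cone_hull => [i|i|f fM].
  + apply: dual_lattice_zspan => -[p k].
    by exists (T7_ray_value i p k)%:Z; rewrite T7_rayE.
  + by rewrite evE T7_ray_center.
  + by rewrite evE; exact: fM.
- by rewrite !linearD /= !T7_heightE -addrA.
Qed.

End T7Rays.

(** * The Cayley structure *)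

Section T7Cayley.
Variable R : realType.

Local Notation A := (A_in_M_R R).

(** The correction by [eps] coordinates sends every A (0, k) to 0, so that all slices share the
    vertex 0. *)
Definition slice_coordinate (q : 'I_6) : 'Hom(M_R R, R^o) :=
  T7_ray R (inl (lift ord0 q, 0))
  - \sum_(k : 'I_3) (staircase (lift ord0 q) 0 0 k)%:R *: T7_ray R (inr k).

Definition slice_vertex (k : 'I_3) (p : 'I_7) : 'rV[R]_6 :=
  \row_q ((staircase (lift ord0 q) 0 p k)%:R - (staircase (lift ord0 q) 0 0 k)%:R).

Definition split_map_fun (u : M_R R) : 'rV[R]_3 * 'rV[R]_6 :=
  (\row_k T7_ray R (inr k) u, \row_q slice_coordinate q u).

Fact split_map_linear : linear split_map_fun.
Proof.
move=> a u v; apply: injective_projections; apply/rowP => i; rewrite !mxE;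
  by rewrite linearP.
Qed.
HB.instance Definition _ :=
  GRing.isLinear.Build R _ _ _ split_map_fun split_map_linear.

Definition split_map : 'Hom(M_R R, ('rV[R]_3 * 'rV[R]_6)%type) :=
  linfun split_map_fun.

Lemma split_mapE p k : split_map (A (p, k)) = (delta_mx 0 k, slice_vertex k p).
Proof.
rewrite lfunE /= /split_map_fun; congr (_, _); apply/rowP => i; rewrite !mxE.
  by rewrite T7_rayE /= [k == i]eq_sym.
rewrite add_lfunE opp_lfunE sum_lfunE T7_rayE; congr (_ - _).
rewrite (bigD1 k) // scale_lfunE T7_rayE /T7_ray_value eqxx [_ *: _]mulr1.
rewrite big1 => [|l lk]; first exact: addr0.
rewrite scale_lfunE T7_rayE /T7_ray_value.
by rewrite [k == l]eq_sym (negPf lk) [_ *: _]mulr0.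
Qed.

Lemma slice_vertex0 k : slice_vertex k 0 = 0.
Proof. by apply/rowP => q; rewrite !mxE subrr. Qed.

(** For j = k = 0 the staircase of q is the single point q. *)
Lemma slice_vertex_delta q : slice_vertex 0 (lift ord0 q) = delta_mx 0 q.
Proof.
apply/rowP => r; rewrite !mxE.
case: q => -[|[|[|[|[|[|//]]]]]] ?; case: r => -[|[|[|[|[|[|//]]]]]] ? /=;
  by rewrite ?subr0.
Qed.

(** Compares steps by [tau k] in slice k with steps by [tau 0] in slice 0, whose vertices are 0 and
    the unit vectors. *)
Lemma slice_vertex_exchange k p :
  slice_vertex k p - slice_vertex k (p - tau k) =
  slice_vertex 0 p - slice_vertex 0 (p - tau 0).
Proof.
have := congr1 (fun u => (split_map u).2) (A_exchange R p k 0).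
rewrite !linearD /= !split_mapE /= => E.
by apply/eqP; rewrite subr_eq addrAC -E addrK.
Qed.

(* The vectors A (0, k) and A (q, 0) - A (0, 0), q <> 0, form a basis of M. *)
Definition split_inv (u : 'rV[R]_3 * 'rV[R]_6) : M_R R :=
  \sum_k u.1 0 k *: A (0, k) + \sum_q u.2 0 q *: (A (lift ord0 q, 0) - A (0, 0)).

Fact split_inv_linear : linear split_inv.
Proof.
move=> a u v; rewrite /split_inv scalerDr !scaler_sumr addrACA -!big_split /=.
by congr (_ + _); apply: eq_bigr => i _; rewrite !mxE scalerDl scalerA.
Qed.
HB.instance Definition _ :=
  GRing.isLinear.Build R _ _ _ split_inv split_inv_linear.

Lemma split_mapA u : split_map (split_inv u) = u.
Proof.
rewrite /split_inv linearD !linear_sum.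
under eq_bigr do rewrite linearZ /= split_mapE slice_vertex0.
under [X in _ + X]eq_bigr do
  rewrite linearZ linearB /= !split_mapE slice_vertex0 slice_vertex_delta.
apply: injective_projections; rewrite /= !(raddf_sum fst, raddf_sum snd) /=.
  rewrite [X in _ + X]big1 => [|q _]; last by rewrite subrr scaler0.
  by rewrite addr0 [RHS]row_sum_delta.
rewrite big1 ?add0r => [|k _]; last exact: scaler0.
by rewrite [RHS]row_sum_delta; apply: eq_bigr => q _; rewrite subr0.
Qed.

Lemma split_invA u : split_inv (split_map u) = u.
Proof.
suff E : (linfun split_inv \o split_map)%VF = \1%VF.
  by have := congr1 (fun f : 'Hom(M_R R, M_R R) => f u) E; rewrite comp_lfunE lfunE id_lfunE.
apply: eq_on_A => -[p k]; rewrite comp_lfunE split_mapE lfunE id_lfunE /= /split_inv /=.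
rewrite (bigD1 k) //= mxE !eqxx scale1r big1 ?addr0 => [|l /negPf lk]; last first.
  by rewrite mxE eqxx lk scale0r.
pose lc (w : 'rV[R]_6) := \sum_q w 0 q *: (A (lift ord0 q, 0) - A (0, 0)).
rewrite -/(lc _); suff -> : lc (slice_vertex k p) = A (p, k) - A (0, k) by rewrite addrC subrK.
have lcB v w : lc (v - w) = lc v - lc w.
  by rewrite /lc -sumrB; apply: eq_bigr => q _; rewrite !mxE scalerBl.
have lc0 : lc 0 = 0 by rewrite /lc big1 // => q _; rewrite mxE scale0r.
have lcA0 r : lc (slice_vertex 0 r) = A (r, 0) - A (0, 0).
  case: (unliftP ord0 r) => [q ->|->]; last by rewrite slice_vertex0 lc0 subrr.
  rewrite slice_vertex_delta /lc (bigD1 q) //= mxE !eqxx scale1r big1 ?addr0 //.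
  by move=> s /negPf sq; rewrite mxE sq scale0r.
(* A step by [tau k] changes each side as the step by [tau 0] does in slice 0, where [lcA0] gives
   the value. *)
elim/(translation_ind (k := k)): p => [|p IHp].
  by rewrite slice_vertex0 lc0 subrr.
have := lcB (slice_vertex k p) (slice_vertex k (p - tau k)).
rewrite slice_vertex_exchange lcB !lcA0 IHp.
move/eqP; rewrite eq_sym subr_eq => /eqP->.
have E : A (p, 0) - A (p - tau 0, 0) = A (p, k) - A (p - tau k, k).
  by apply/eqP; rewrite subr_eq addrAC A_exchange addrK.
by rewrite opprB [X in X + _]addrA subrK E addrA subrK.
Qed.

Lemma split_map_bij : bijective split_map.
Proof. by exists split_inv; [exact: split_invA | exact: split_mapA]. Qed.

Lemma dim_M_R : dim (M_R R) = 9.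
Proof.
have inj : lker split_map = 0%VS.
  by apply/eqP/lker0P; exact: bij_inj split_map_bij.
rewrite -dimvf -(limg_dim_eq (f := split_map)) ?inj ?capv0 //.
have -> : limg split_map = fullv.
  by apply/vspaceP => u; rewrite memvf -(split_mapA u) memv_img ?memvf.
by rewrite dimvf.
Qed.

Lemma cone_dim_sigma_dual : cone_dim (sigma_dual R) 9.
Proof.
exists fullv; split=> [x _|U UC|]; first exact: memvf.
  apply/subvP => u _; have [c ->] := M_R_generated u.
  by apply: memv_suml => pk _; apply/memvZ/UC/cone_hull_gen.
by rewrite dimvf dim_M_R.
Qed.

Definition slice_lattice : set 'rV[R]_6 := zspan (fun q : 'I_6 => delta_mx 0 q).

Lemma slice_lattice_full : is_lattice slice_lattice.
Proof.
exists 6, [tuple delta_mx 0 q | q < 6]; split; last first.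
  by congr zspan; apply/funext => q; rewrite tnth_mktuple.
rewrite basisEdim size_tuple dimvf andbT.
apply/subvP => w _; rewrite (row_sum_delta w); apply: memv_suml => q _.
apply/memvZ/memv_span; rewrite -(tnth_mktuple (fun q => delta_mx 0 q)).
exact: mem_tnth.
Qed.

Lemma slice_vertexL k p : slice_lattice (slice_vertex k p).
Proof.
exists (fun q => (staircase (lift ord0 q) 0 p k)%:Z - (staircase (lift ord0 q) 0 0 k)%:Z).
rewrite [LHS]row_sum_delta; apply: eq_bigr => q _.
by rewrite mxE -scaler_int intrB.
Qed.

Lemma split_map_lattice :
  split_map @` lattice_M R = @cayley_lattice _ _ 3 slice_lattice.
Proof.
apply/seteqP; split=> [u|u [lz [y wE]]].
  rewrite image_zspan => -[z ->].
  have -> : \sum_pk split_map (A pk) *~ z pk =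
      \sum_pk ((delta_mx 0 pk.2, slice_vertex pk.2 pk.1) : 'rV_3 * 'rV_6) *~ z pk.
    by apply: eq_bigr => -[p k] _; rewrite split_mapE.
  split.
    move=> i; exists (\sum_pk (i == pk.2)%:Z * z pk).
    rewrite (raddf_sum fst) summxE rmorph_sum; apply: eq_bigr => pk _.
    by rewrite raddfMz -scaler_int !mxE rmorphM mulrC.
  rewrite (raddf_sum snd); apply: zspan_sum => pk.
  rewrite raddfMz /=; apply: zspan_mulz; exact: slice_vertexL.
(* Integral coordinates give an integral combination of the A. *)
exists (split_inv u); last exact: split_mapA.
apply: zspan_add; apply: zspan_sum => i.
  have [x ->] := lz i; rewrite scaler_int; apply: zspan_mulz; exact: zspan_gen.
have -> : u.2 0 i = (y i)%:~R.
  rewrite wE summxE (bigD1 i) //= big1 => [|q qi]; rewrite -scaler_int !mxE ?eqxx.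
    by rewrite mulr1 addr0.
  by rewrite [i == q]eq_sym (negPf qi) mulr0.
rewrite scaler_int; apply/zspan_mulz/zspan_add; first exact: zspan_gen.
by rewrite -mulrN1z; apply/zspan_mulz/zspan_gen.
Qed.

(** The edge vectors at 0 span the vertices of slice k, hence by exchange those of slice 0, hence
    the unit vectors; six vectors spanning a space of dimension 6 are free. *)
Lemma slice_simplex k : lattice_simplex slice_lattice 6 (convex_hull (slice_vertex k)).
Proof.
exists (slice_vertex k); split=> // [p|]; first exact: slice_vertexL.
set s := [seq _ | _ <- _].
have vs p : slice_vertex k p \in <<s>>%VS.
  case: (unliftP ord0 p) => [i ->|->]; last by rewrite slice_vertex0 mem0v.
  rewrite -[slice_vertex k _]subr0 -[X in _ - X](slice_vertex0 k).
  by apply/memv_span/mapP; exists i; rewrite ?mem_enum.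
have v0s p : slice_vertex 0 p \in <<s>>%VS.
  elim/(translation_ind (k := 0)): p => [|p IHp]; first by rewrite slice_vertex0 mem0v.
  by rewrite -(subrK (slice_vertex 0 (p - tau 0)) (slice_vertex 0 p)) memvD // -(slice_vertex_exchange k) memvB.
have sfull : <<s>>%VS = fullv.
  apply/vspaceP => w; rewrite memvf (row_sum_delta w).
  by apply: memv_suml => q _; rewrite -slice_vertex_delta memvZ.
by rewrite /free sfull dimvf size_map size_enum_ord.
Qed.

Lemma slice_polytope k : lattice_polytope slice_lattice (convex_hull (slice_vertex k)).
Proof. by exists 6, (slice_vertex k); split=> // p; exact: slice_vertexL. Qed.

Lemma sigma_dual_cayley :
  is_cayley_cone_over (lattice_M R) (sigma_dual R) slice_lattice
    (fun k : 'I_3 => convex_hull (slice_vertex k)).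
Proof.
exists split_map; split; first exact: split_map_bij.
  exact: split_map_lattice.
rewrite image_cone_hull cayley_cone_simplices; congr cone_hull.
by apply/funext => -[p k]; rewrite split_mapE.
Qed.

End T7Cayley.

Theorem theorem7p1 (R : realType) :
  [/\ cone_dim (sigma_dual R) 9,
      completely_split (lattice_M R) (sigma_dual R) 3
    & exists (W : vectType R) (Lambda : set W) (D : 'I_3 -> set W),
        [/\ is_lattice Lambda, forall i, lattice_simplex Lambda 6 (D i)
          & is_cayley_cone_over (lattice_M R) (sigma_dual R) Lambda D]].
Proof.
have lat := slice_lattice_full R; have cay := sigma_dual_cayley R.
split; first exact: cone_dim_sigma_dual.
  split; first exact: sigma_dual_reflexive.
  by do 3!eexists; split; [exact: lat | exact: slice_polytope | exact: cay].
by do 3!eexists; split; [exact: lat | exact: slice_simplex | exact: cay].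
Qed.
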